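(* Fix integers $m,n\ge1$ and let $f\in\mathfrak{F}$ (the family defined in the context). Then there exists a function $g:\mathbb{Z}_+\to(0,1]$ such that for any real $n\times m$ matrix $\Theta$ the following holds: if the inequality $$\|\Theta q\|<\frac{f(|q|)}{|q|^{m/n}}$$ has infinitely many solutions $q\in\mathbb{Z}^m\setminus\{0\}$, then the stronger inequality $$\|\Theta q\|<\frac{f(|q|)-g(|q|)}{|q|^{m/n}}$$ also has infinitely many solutions $q\in\mathbb{Z}^m\setminus\{0\}$.
   Context: $\mathbb{Z}_+$ is the set of positive integers. For $q=(q_1,\dots,q_m)\in\mathbb{Z}^m$, $|q|=\max_i|q_i|$; for a real $n\times m$ matrix $\Theta$, $\|\Theta q\|=\min_{p\in\mathbb{Z}^n}|\Theta q-p|$, where $|\cdot|$ is the max norm on $\mathbb{R}^n$. Let $\mathcal{R}$ be the set of real $n\times m$ matrices with all entries in $[0,1]$. For $f:\mathbb{Z}_+\to\mathbb{R}_+$ and $q\in\mathbb{Z}^m\setminus\{0\}$ set $M_q[f]=\{\Theta\in\mathcal{R}: \|\Theta q\|<\frac{f(|q|)}{2|q|^{m/n}}\}$, $M_q^c[f]=\mathcal{R}\setminus M_q[f]$, and $\mathcal{M}^c[f]=\bigcup_{Q=1}^\infty\bigcap_{q\in\mathbb{Z}^m,|q|\ge Q}M_q^c[f]$. The family $\mathfrak{F}$ consists of all functions $f:\mathbb{Z}_+\to\mathbb{R}_+$ for which there exists $Q=Q[f]$ such that for every $\Theta\in\mathcal{M}^c[f]$ and every $q\in\mathbb{Z}^m$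 with $|q|\ge Q$ one has $|q|^{m/n}\cdot\|\Theta q\|\neq f(|q|)$. *)

(* Defs.v *)
From mathcomp Require Import all_boot all_order all_algebra lra.
From mathcomp Require Import all_classical all_reals all_analysis.

Set Implicit Arguments.
Unset Strict Implicit.
Unset Printing Implicit Defensive.

Import Order.TTheory GRing.Theory Num.Theory.
Import numFieldNormedType.Exports.

Local Open Scope classical_set_scope.
Local Open Scope ring_scope.

(* The max norm |q| of an integer vector, as a natural number. *)
Definition height (m : nat) (q : 'cV[int]_m) : nat := (\max_(i < m) `|q i ord0|)%N.

Definition real_of_int_cV (R : realType) (k : nat) (p : 'cV[int]_k) : 'cV[R]_k :=
  map_mx (fun z : int => z%:~R) p.
Arguments real_of_int_cV R {k} p.

(* min_{p in Z^n} |x - p|; the matrix norm of MathComp-Analysis is the max norm,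
   and dist_int_min shows that the infimum is a minimum. *)
Definition dist_int (R : realType) (n : nat) (x : 'cV[R]_n) : R :=
  inf [set `|x - real_of_int_cV R p| | p in [set: 'cV[int]_n]].

Lemma floor_half_nearest (R : realType) (y : R) (z : int) :
  `|y - (Num.floor (y + 2^-1))%:~R| <= `|y - z%:~R|.
Proof.
set f := Num.floor _.
have f1 : f%:~R <= y + 2^-1 by exact: floor_le.
have f2 : y + 2^-1 < f%:~R + 1.
  by have := floorD1_gt (y + 2^-1); rewrite intrD.
have hf : `|y - f%:~R| <= 2^-1 by rewrite ler_norml; apply/andP; split; lra.
case: (ltgtP z f) => [zf|fz|->//]; apply: le_trans hf _.
- have : (z + 1)%:~R <= f%:~R :> R by rewrite ler_int lezD1.
  by rewrite intrD => h; rewrite ler_normr; apply/orP; left; lra.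
- have : (f + 1)%:~R <= z%:~R :> R by rewrite ler_int lezD1.
  by rewrite intrD => h; rewrite ler_normr; apply/orP; right; lra.
Qed.

Lemma dist_int_min (R : realType) (n : nat) (x : 'cV[R]_n) :
  exists p : 'cV[int]_n, dist_int x = `|x - real_of_int_cV R p| /\
    forall p' : 'cV[int]_n, dist_int x <= `|x - real_of_int_cV R p'|.
Proof.
have lb : has_lbound [set `|x - real_of_int_cV R p| | p in [set: 'cV[int]_n]].
  by exists 0 => _ [p _ <-].
have le p' : dist_int x <= `|x - real_of_int_cV R p'|.
  by apply: ge_inf => //; exists p'.
pose p0 : 'cV[int]_n := \matrix_(i, j) Num.floor (x i j + 2^-1).
exists p0; split=> //; apply/eqP; rewrite eq_le le /=.
apply: lb_le_inf; first by exists `|x - real_of_int_cV R p0|; exists p0.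
move=> _ [p _ <-]; rewrite [leLHS]/Num.norm /= mx_normrE.
apply/bigmax_leP; split=> // -[i j] _ /=.
apply: (@le_trans _ _ `|x i j - (p i j)%:~R|).
  by rewrite !mxE; exact: floor_half_nearest.
rewrite [leRHS]/Num.norm /= mx_normrE; apply/bigmax_geP; right.
by exists (i, j) => //=; rewrite !mxE.
Qed.

(* The quantities ||Theta q|| and |q|^{m/n}. *)
Definition form_dist (R : realType) (n m : nat) (Theta : 'M[R]_(n, m))
    (q : 'cV[int]_m) : R :=
  dist_int (Theta *m real_of_int_cV R q).

Definition weight (R : realType) (n m : nat) (q : 'cV[int]_m) : R :=
  (height q)%:R `^ (m%:R / n%:R).
Arguments weight R n {m} q.

Definition unit_matrices (R : realType) (n m : nat) : set 'M[R]_(n, m) :=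
  [set Theta | forall i j, 0 <= Theta i j <= 1].

(* Functions on the positive integers are represented by functions on nat whose
   value at 0 is irrelevant: they are only evaluated at |q| for q <> 0. *)
Definition Mq (R : realType) (n m : nat) (f : nat -> R) (q : 'cV[int]_m) :
    set 'M[R]_(n, m) :=
  [set Theta | unit_matrices Theta /\
               form_dist Theta q < f (height q) / (2 * weight R n q)].

Definition Mqc (R : realType) (n m : nat) (f : nat -> R) (q : 'cV[int]_m) :
    set 'M[R]_(n, m) :=
  @unit_matrices R n m `\` Mq f q.

Definition Mc (R : realType) (n m : nat) (f : nat -> R) : set 'M[R]_(n, m) :=
  \bigcup_(Q in [set Q : nat | (1 <= Q)%N])
    \bigcap_(q in [set q : 'cV[int]_m | (Q <= height q)%N]) Mqc f q.

Definition familyF (R : realType) (n m : nat) : set (nat -> R) :=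
  [set f | (forall k : nat, (1 <= k)%N -> 0 <= f k) /\
    exists2 Q : nat, (1 <= Q)%N &
      forall Theta : 'M[R]_(n, m), Mc f Theta ->
      forall q : 'cV[int]_m, (Q <= height q)%N ->
        weight R n q * form_dist Theta q <> f (height q)].
Arguments familyF R n m : clear implicits.

(* Main.v *)
Require Import Defs.
From mathcomp Require Import all_boot all_order all_algebra zify lra.
From mathcomp Require Import all_classical all_reals all_analysis.

Set Implicit Arguments.
Unset Strict Implicit.
Unset Printing Implicit Defensive.

Import Order.TTheory GRing.Theory Num.Theory.
Import numFieldNormedType.Exports.

Local Open Scope classical_set_scope.
Local Open Scope ring_scope.

(** Adding an integer matrix to Theta does not change [form_dist], so Theta may
    be taken with entries in [0, 1]. The matrices with
    [form_dist Theta q >= f |q| / (2 |q|^(m/n))] whenever [|q| >= k] form a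
    compact set, on which the continuous functions
    [|q|^(m/n) * form_dist Theta q], for the finitely many q with [|q| = k],
    avoid the value [f k] since f is in the family; they hence stay at some
    distance d k from it. Take g k := min(1, d k / 2, f k / 2), without the last
    term when f k = 0, where the inequality with f has no solution. If the
    inequality with f - g fails for all large q, then g <= f / 2 (where f > 0)
    places Theta in these compact sets for all large k, so every solution q of
    large height of the inequality with f also solves the one with f - g: a
    contradiction. *)

(** * Continuity of [form_dist] in the matrix *)

Lemma lipschitz_continuous (R : realType) (V W : normedModType R) (C : R)
    (F : V -> W) :
  (forall x y, `|F x - F y| <= C * `|x - y|) -> continuous F.
Proof.
move=> lipF x; apply/cvgrPdist_lt => e e0.
(* No sign is assumed on [C]; [|C| + 1] is a positive constant above it, so one may divide by it. *)
have C1 : 0 < `|C| + 1 by rewrite ltr_wpDl.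
have : \forall y \near x, `|x - y| < e / (`|C| + 1).
  by apply: (@cvgr_dist_lt _ _ _ _ _ id); [exact: cvg_id | exact: divr_gt0].
apply: filterS => y; rewrite ltr_pdivlMr// => h.
apply: le_lt_trans (lipF x y) _; apply: le_lt_trans h.
by rewrite mulrC ler_wpM2l//; have := ler_norm C; lra.
Qed.

Lemma mx_norm_le (R : realType) (a b : nat) (A : 'M[R]_(a, b)) (c : R) :
  0 <= c -> (forall i j, `|A i j| <= c) -> `|A| <= c.
Proof.
move=> c0 h; rewrite [leLHS]/Num.norm /= mx_normrE.
by apply/bigmax_leP; split=> // -[i j] _ /=.
Qed.

Lemma coef_le_mx_norm (R : realType) (a b : nat) (A : 'M[R]_(a, b)) i j :
  `|A i j| <= `|A|.
Proof.
rewrite [leRHS]/Num.norm /= mx_normrE.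
by apply/bigmax_geP; right; exists (i, j).
Qed.

Lemma vec_mx_continuous (R : realType) (a b : nat) :
  continuous (@vec_mx R a b).
Proof.
apply: (@lipschitz_continuous _ _ _ 1) => x y.
rewrite mul1r -linearB; apply: mx_norm_le => // i j.
by rewrite mxE; exact: coef_le_mx_norm.
Qed.

Lemma mulmxr_continuous (R : realType) (a b c : nat) (B : 'M[R]_(b, c)) :
  continuous (fun A : 'M[R]_(a, b) => A *m B).
Proof.
(* The constant is [b] times the norm of [B], kept as a sum to be compared termwise with an entry of
   the product. *)
apply: (@lipschitz_continuous _ _ _ (\sum_(j < b) `|B|)) => x y.
rewrite -mulmxBl; apply: mx_norm_le => [|i k].
  by rewrite mulr_ge0// sumr_ge0.
rewrite mxE mulr_suml; apply: le_trans (ler_norm_sum _ _ _) _.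
apply: ler_sum => j _; rewrite normrM mulrC.
by apply: ler_pM => //; exact: coef_le_mx_norm.
Qed.

(** Triangle inequality through [y], at an integer point nearest to [y]. *)
Lemma dist_int_le (R : realType) (n : nat) (x y : 'cV[R]_n) :
  dist_int x <= `|x - y| + dist_int y.
Proof.
have [p [-> _]] := dist_int_min y; have [_ [_ h]] := dist_int_min x.
by apply: le_trans (h p) _; exact: ler_distD.
Qed.

Lemma dist_int_continuous (R : realType) (n : nat) :
  continuous (@dist_int R n).
Proof.
apply: (@lipschitz_continuous _ _ _ 1) => x y; rewrite mul1r.
have := dist_int_le x y; have := dist_int_le y x; rewrite (distrC y x).
by move=> h1 h2; rewrite ler_norml; apply/andP; split; lra.
Qed.

Lemma dist_int_ge0 (R : realType) (n : nat) (x : 'cV[R]_n) : 0 <= dist_int x.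
Proof. by have [p [-> _]] := dist_int_min x. Qed.

Lemma dist_intD_int (R : realType) (n : nat) (x : 'cV[R]_n) (z : 'cV[int]_n) :
  dist_int (x + real_of_int_cV R z) = dist_int x.
Proof.
(* One inequality suffices: shifting back by [- z] gives the other. *)
have shift_le (y : 'cV[R]_n) w : dist_int (y + real_of_int_cV R w) <= dist_int y.
  have [p [-> _]] := dist_int_min y.
  have [_ [_ /(_ (p + w))]] := dist_int_min (y + real_of_int_cV R w).
  have -> : real_of_int_cV R (p + w) = real_of_int_cV R p + real_of_int_cV R w.
    by apply/matrixP => i j; rewrite !mxE intrD.
  by rewrite opprD addrACA subrr addr0.
apply/eqP; rewrite eq_le shift_le /=.
have := shift_le (x + real_of_int_cV R z) (- z).
have -> : real_of_int_cV R (- z) = - real_of_int_cV R z.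
  by apply/matrixP => i j; rewrite !mxE intrN.
by rewrite addrK.
Qed.

Lemma form_dist_continuous (R : realType) (n m : nat) (q : 'cV[int]_m) :
  continuous (fun Theta : 'M[R]_(n, m) => form_dist Theta q).
Proof.
move=> Theta; rewrite /form_dist.
apply: (continuous_comp (f := fun A : 'M[R]_(n, m) => A *m real_of_int_cV R q)).
  exact: mulmxr_continuous.
exact: dist_int_continuous.
Qed.

(** * Reduction modulo integer matrices *)

Lemma form_distD_int (R : realType) (n m : nat) (Theta : 'M[R]_(n, m))
    (Z : 'M[int]_(n, m)) (q : 'cV[int]_m) :
  form_dist (Theta + map_mx intr Z) q = form_dist Theta q.
Proof.
rewrite /form_dist mulmxDl -(dist_intD_int (Theta *m _) (Z *m q)).
by congr (dist_int (_ + _)); rewrite /real_of_int_cV map_mxM.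
Qed.

Lemma form_dist_unit_repr (R : realType) (n m : nat) (Theta : 'M[R]_(n, m)) :
  exists2 Theta' : 'M[R]_(n, m), unit_matrices Theta' &
    forall q, form_dist Theta' q = form_dist Theta q.
Proof.
exists (Theta + map_mx intr (map_mx (fun x => - Num.floor x) Theta)).
  move=> i j; rewrite !mxE intrN.
  have := floor_le (Theta i j); have := floorD1_gt (Theta i j).
  by rewrite intrD => h1 h2; apply/andP; split; lra.
by move=> q; exact: form_distD_int.
Qed.

(** * Compactness and avoided values *)

Lemma unit_matrices_compact (R : realType) (n m : nat) :
  compact (@unit_matrices R n m).
Proof.
(* Flattened to row vectors, the matrices form a product of segments, compact by [rV_compact]. *)
have -> : @unit_matrices R n m = vec_mx @`
    [set v : 'rV[R]_(n * m) | forall i, `[0, 1]%classic (v ord0 i)].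
  apply/seteqP; split=> [A h|_ [v h <-] i j].
    exists (mxvec A); last exact: mxvecK.
    by move=> k; case/mxvec_indexP: k => i j; rewrite mxvecE /= in_itv /= h.
  by rewrite mxE; have := h (mxvec_index i j); rewrite /= in_itv.
apply: continuous_compact; first exact/continuous_subspaceT/vec_mx_continuous.
apply: (@rV_compact R (n * m) (fun=> `[0, 1]%classic)) => _.
exact: segment_compact.
Qed.

(** Inside [unit_matrices], each [Mqc f q] is cut out by a non-strict inequality on a continuous
    function. The explicit factor [unit_matrices] keeps the set compact even for empty [D]. *)
Lemma bigcap_Mqc_compact (R : realType) (n m : nat) (f : nat -> R)
    (D : set 'cV[int]_m) :
  compact (@unit_matrices R n m `&` \bigcap_(q in D) Mqc f q).
Proof.
have -> : @unit_matrices R n m `&` \bigcap_(q in D) Mqc f q =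
    @unit_matrices R n m `&` \bigcap_(q in D)
      [set Theta | f (height q) / (2 * weight R n q) <= form_dist Theta q].
  apply/seteqP; split=> Theta [hU h]; split=> // q Dq.
    have [_ hq] := h q Dq; rewrite /= leNgt; apply/negP => lt.
    by apply: hq; split.
  by split=> // -[_]; rewrite ltNge (h q Dq).
apply: compact_closedI; first exact: unit_matrices_compact.
apply: closed_bigI => q _.
apply: (preimage_closed (f := fun Theta : 'M[R]_(n, m) => form_dist Theta q)
  (D := [set x | f (height q) / (2 * weight R n q) <= x])) => [A _|].
  exact: form_dist_continuous.
exact: closed_ge.
Qed.

(** The distance from [F x] to [c] attains its minimum on a nonempty [K], and that minimum is not
    zero. *)
Lemma compact_avoid_gap (R : realType) (T : topologicalType) (K : set T)
    (F : T -> R) (c : R) :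
  compact K -> continuous F -> (forall x, K x -> F x <> c) ->
  exists2 d : R, 0 < d & forall x, K x -> d <= `|F x - c|.
Proof.
move=> cK cF Fc; have [K0|K0] := pselect (K !=set0); last first.
  by exists 1 => // x Kx; exfalso; apply: K0; exists x.
have [|x Kx minx] := @compact_EVT_min _ _ (fun x => `|F x - c|) K K0 cK.
  apply/continuous_subspaceT => x.
  by apply: cvg_norm; apply: cvgB; [exact: cF | exact: cvg_cst].
exists `|F x - c|; last by move=> y Ky; apply: minx; rewrite inE.
by rewrite normr_gt0 subr_eq0; apply/eqP/Fc; rewrite inE in Kx.
Qed.

(** * Integer vectors and their heights *)

Lemma coef_le_height (m : nat) (q : 'cV[int]_m) i j : (`|q i j| <= height q)%N.
Proof. by rewrite (ord1 j) /height (bigD1 i) //= leq_maxl. Qed.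

Lemma finite_height_le (m N : nat) :
  finite_set [set q : 'cV[int]_m | (height q <= N)%N].
Proof.
(* Entries between [- N] and [N], shifted by [N], are ordinals below [2N + 1], so a finite type
   covers the set. *)
pose dec (x : 'cV['I_(N + N).+1]_m) : 'cV[int]_m :=
  map_mx (fun k : 'I__ => (k : nat)%:Z - N%:Z) x.
apply: (@sub_finite_set _ _ (dec @` setT)); last exact/finite_image/finite_finset.
move=> q /= hq; exists (map_mx (fun z : int => inord (absz (z + N%:Z))) q) => //.
apply/matrixP => i j; rewrite !mxE.
have := leq_trans (coef_le_height q i j) hq.
by move: (q i j) => z hz; rewrite inordK; lia.
Qed.

Lemma finite_height_bounded (m : nat) (A : set 'cV[int]_m) :
  finite_set A -> exists N, forall q, A q -> (height q < N)%N.
Proof.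
move=> /finite_seqP [s ->]; exists (\max_(q <- s) height q).+1 => q /= qs.
by rewrite ltnS (big_rem q)//= leq_maxl.
Qed.

Lemma infinite_height_unbounded (m N : nat) (A : set 'cV[int]_m) :
  infinite_set A -> exists2 q, A q & (N <= height q)%N.
Proof.
move=> infA; apply: contrapT => noq; apply: infA.
apply: sub_finite_set (finite_height_le m N) => q Aq /=.
by rewrite leqNgt; apply/negP => h; apply: noq; exists q => //; exact: ltnW.
Qed.

Lemma height_gt0 (m : nat) (q : 'cV[int]_m) : (0 < height q)%N <-> q <> 0.
Proof.
split=> [h q0|q0].
  move: h; rewrite q0 /height big1// => i _.
  by rewrite mxE.
rewrite lt0n; apply/eqP => h; apply: q0; apply/matrixP => i j.
by rewrite mxE; have := coef_le_height q i j; rewrite h leqn0 absz_eq0 => /eqP.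
Qed.

Lemma weight_gt0 (R : realType) (n m : nat) (q : 'cV[int]_m) :
  q <> 0 -> 0 < weight R n q.
Proof. by move=> /height_gt0 h; rewrite powR_gt0// ltr0n. Qed.

(** * A common gap for all vectors of one height *)

Lemma finite_uniform_gap (R : realType) (T : choiceType) (A : set T)
    (P : T -> R -> Prop) :
  finite_set A -> (forall q d e, e <= d -> P q d -> P q e) ->
  (forall q, A q -> exists2 d : R, 0 < d & P q d) ->
  exists2 d : R, 0 < d & forall q, A q -> P q d.
Proof.
move=> /finite_seqP [s ->] mono; elim: s => [|q s IHs] h.
  by exists 1.
have [d d0 Pd] : exists2 d : R, 0 < d & P q d.
  by apply: h; rewrite /= mem_head.
have [r rs|e e0 Pe] := IHs.
  by apply: h; rewrite /= inE rs orbT.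
exists (Num.min d e); first by rewrite lt_min d0.
move=> r; rewrite /= inE => /predU1P[->|rs].
  by apply: mono Pd; rewrite ge_min lexx.
by apply: mono (Pe r rs); rewrite ge_min lexx orbT.
Qed.

Lemma familyF_gap (R : realType) (n m : nat) (f : nat -> R) (Q k : nat) :
  (forall Theta : 'M[R]_(n, m), Mc f Theta ->
     forall q : 'cV[int]_m, (Q <= height q)%N ->
       weight R n q * form_dist Theta q <> f (height q)) ->
  (1 <= k)%N -> (Q <= k)%N ->
  exists2 d : R, 0 < d & forall q : 'cV[int]_m, height q = k ->
    forall Theta : 'M[R]_(n, m), unit_matrices Theta ->
      (forall q', (k <= height q')%N -> Mqc f q' Theta) ->
      d <= `|weight R n q * form_dist Theta q - f k|.
Proof.
move=> avoid k1 Qk.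
apply: (@finite_uniform_gap _ _ [set q | height q = k] (fun q d => forall Theta,
    unit_matrices Theta -> _ -> d <= `|weight R n q * form_dist Theta q - f k|)).
- by apply: sub_finite_set (finite_height_le m k) => q /= ->.
- by move=> q d e ed h Theta U K; apply: le_trans ed (h _ U K).
move=> q /= qk.
have [||d d0 hd] := @compact_avoid_gap R _ _
    (fun Theta => weight R n q * form_dist Theta q) (f k)
    (@bigcap_Mqc_compact R n m f [set q' | (k <= height q')%N]).
- move=> Theta.
  apply: (continuous_comp (f := fun A : 'M[R]_(n, m) => form_dist A q)
    (g := *%R (weight R n q))).
    exact: form_dist_continuous.
  exact: mulrl_continuous.
- move=> Theta [_ K]; rewrite -qk; apply: avoid; last by rewrite qk.
  (* The height [k] itself is the threshold that witnesses membership in [Mc f]. *)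
  by exists k.
by exists d => // Theta U K; apply: hd.
Qed.

(** * Construction of [g] and the contradiction *)

Theorem theorem3 (R : realType) (m n : nat) (hm : (1 <= m)%N) (hn : (1 <= n)%N)
    (f : nat -> R) (hf : familyF R n m f) :
  exists g : nat -> R,
    (forall k : nat, (1 <= k)%N -> 0 < g k <= 1) /\
    forall Theta : 'M[R]_(n, m),
      infinite_set [set q : 'cV[int]_m | q <> 0 /\
        form_dist Theta q < f (height q) / weight R n q] ->
      infinite_set [set q : 'cV[int]_m | q <> 0 /\
        form_dist Theta q < (f (height q) - g (height q)) / weight R n q].
Proof.
case: hf => f0 [Q Q1 avoid].
pose good k (e : R) := [/\ 0 < e <= 1, 0 < f k -> e <= f k / 2 &
  (Q <= k)%N -> forall q : 'cV[int]_m, height q = k ->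
    forall Theta : 'M[R]_(n, m), unit_matrices Theta ->
      (forall q', (k <= height q')%N -> Mqc f q' Theta) ->
      e < `|weight R n q * form_dist Theta q - f k|].
have /choice [g gP] k : exists e, (1 <= k)%N -> good k e.
  have [k1|] := boolP (1 <= k)%N; last by exists 0.
  pose c := if 0 < f k then f k / 2 else 1.
  have c0 : 0 < c by rewrite /c; case: ifP => // fk; rewrite divr_gt0.
  have [d d0 hd] : exists2 d : R, 0 < d & (Q <= k)%N ->
      forall q : 'cV[int]_m, height q = k ->
      forall Theta : 'M[R]_(n, m), unit_matrices Theta ->
      (forall q', (k <= height q')%N -> Mqc f q' Theta) ->
      d <= `|weight R n q * form_dist Theta q - f k|.
    have [Qk|] := boolP (Q <= k)%N; last by exists 1.
    by have [d d0 hd] := familyF_gap avoid k1 Qk; exists d.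
  (* Halving [d] turns the bound [d <= ...] into the strict one that [good] demands. *)
  exists (Num.min 1 (Num.min (d / 2) c)) => _; split.
  - by rewrite !lt_min ltr01 divr_gt0 // c0 ge_min lexx.
  - by move=> fk; rewrite !ge_min /c fk lexx !orbT.
  - move=> Qk q qk Theta U K; apply: lt_le_trans (hd Qk q qk Theta U K).
    rewrite !gt_min; apply/orP; right; apply/orP; left; lra.
exists g; split=> [k /gP[]//|Theta0].
have [ Theta U eqTheta] := form_dist_unit_repr Theta0.
under eq_set do rewrite -eqTheta.
under [in X in _ -> X]eq_set do rewrite -eqTheta.
move=> infA finB.
have [N finN] := finite_height_bounded finB.
have large q : q <> 0 -> (N <= height q)%N ->
    (f (height q) - g (height q)) / weight R n q <= form_dist Theta q.
  move=> q0 Nq; rewrite leNgt; apply/negP => lt.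
  by have := finN q (conj q0 lt); rewrite ltnNge Nq.
have inMqc q : (maxn 1 N <= height q)%N -> Mqc f q Theta.
  rewrite geq_max => /andP[q1 Nq]; split=> // -[_]; apply/negP; rewrite -leNgt.
  have q0 : q <> 0 by apply/height_gt0.
  have w0 := weight_gt0 R n q0.
  have [g01 gf _] := gP _ q1.
  rewrite invfM mulrA.
  (* For positive [f] the bound [large] suffices, as [f - g >= f / 2]; otherwise [f] vanishes and so
     does the threshold in [Mq]. *)
  have [fq|fq] := ltP 0 (f (height q)).
    apply: le_trans (large q q0 Nq); rewrite ler_wpM2r ?invr_ge0 ?(ltW w0)//.
    by have := gf fq; lra.
  have -> : f (height q) = 0 by apply/eqP; rewrite eq_le fq f0.
  by rewrite !mul0r dist_int_ge0.
have [q [q0 lt]] := infinite_height_unbounded (maxn Q (maxn 1 N)) infA.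
rewrite !geq_max => /and3P[Qq q1 Nq].
have w0 := weight_gt0 R n q0.
have [_ _ gap] := gP _ q1.
have : g (height q) < `|weight R n q * form_dist Theta q - f (height q)|.
  apply: gap => // q' qq'; apply: inMqc.
  by rewrite geq_max (leq_trans q1)// (leq_trans Nq).
(* The value [weight * form_dist] lies in [[f - g, f)], hence within [g] of [f], against the gap. *)
move: lt (large q q0 Nq) (gP _ q1) => + + [/andP[g0 _] _ _].
rewrite ltr_pdivlMr// ler_pdivrMr// [form_dist _ _ * _]mulrC => h1 h2.
by apply/negP; rewrite -leNgt ler_norml; apply/andP; split; lra.
Qed.
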